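(* For all integers $n \geq 1$, $$\chi(n) = \left|\{ a \in \mathbb{Z}_n : a^2 = 0 \text{ in } \mathbb{Z}_n \}\right|.$$
   Context: For $n \geq 1$, $\chi(n) = \max\{ s \in \mathbb{N} : s^2 \mid n \}$. $\mathbb{Z}_n = \mathbb{Z}/n\mathbb{Z}$ is the ring of residue classes modulo $n$. *)

(* Defs.v *)
From HB Require Import structures.
From mathcomp Require Import all_boot all_order all_algebra.

Set Implicit Arguments.
Unset Strict Implicit.
Unset Printing Implicit Defensive.

Import GRing.Theory.
Local Open Scope ring_scope.

(* zmodp.v equips 'I_n.+1 only with an additive group, and its ring 'Z_n is
   Z/2Z for n = 1, so the ring Z/nZ is put on an alias that yields the zero
   ring when n = 1. The modulus n.-1.+1 is n for n >= 1; the value at n = 0 is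
   meaningless. *)
Definition Zmod (n : nat) : predArgType := 'I_n.-1.+1.

HB.instance Definition _ (n : nat) := GRing.Zmodule.on (Zmod n).
HB.instance Definition _ (n : nat) := Finite.on (Zmod n).
HB.instance Definition _ (n : nat) :=
  GRing.Zmodule_isComPzRing.Build (Zmod n)
    (@Zp_mulA _) (@Zp_mulC _) (@Zp_mul1z _) (@Zp_mul_addl _).

Lemma card_Zmod (n : nat) : (0 < n)%N -> #|Zmod n| = n.
Proof. by case: n => // n _; rewrite card_ord. Qed.

Lemma natr_Zmod (n k : nat) : k%:R = inZp k :> Zmod n.
Proof.
elim: k => [|k IHk]; first by apply: val_inj; rewrite /= mod0n.
by rewrite mulrS IHk; apply: val_inj; rewrite /= modnDm.
Qed.

Lemma natr_Zmod_eq (n j k : nat) : (0 < n)%N ->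
  (j%:R == k%:R :> Zmod n) = (j == k %[mod n]).
Proof. by case: n => // n _; rewrite !natr_Zmod. Qed.

(* The bound s <= n loses no candidate when n >= 1, see chi_max. *)
Definition chi (n : nat) : nat := (\max_(s < n.+1 | s ^ 2 %| n) s)%N.

Lemma chi_dvd (n : nat) : (0 < n)%N -> (chi n ^ 2 %| n)%N.
Proof.
case: n => // n _; rewrite /chi.
have h1 : ((inord 1 : 'I_n.+2) ^ 2 %| n.+1)%N by rewrite inordK.
by rewrite (bigmax_eq_arg _ h1); case: arg_maxnP.
Qed.

Lemma chi_max (n s : nat) : (0 < n)%N -> (s ^ 2 %| n)%N -> (s <= chi n)%N.
Proof.
move=> n0 hs; case: s hs => // s hs.
have hsn : (s.+1 < n.+1)%N.
  by rewrite ltnS (leq_trans _ (dvdn_leq n0 hs)) // leq_pmulr.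
exact: (@leq_bigmax_cond _ _ (fun i : 'I_n.+1 => i : nat) (Ordinal hsn)).
Qed.

(* Main.v *)
(** Write n = s^2 m with s = chi n, so that m is squarefree. Then n divides a^2
    exactly when s m divides a, and [0, n) contains n / (s m) = s multiples of
    s m. *)
Require Import Defs.
From HB Require Import structures.
From mathcomp Require Import all_boot all_order all_algebra.
Import GRing.Theory.
Local Open Scope ring_scope.

(** With [s = chi n] and [n = m * s^2], maximality of [s] makes [m] squarefree
    ([chi_cofactor_squarefree]). If [n] divides [a^2], then [s] divides [a]; for [a = b * s] the
    condition becomes that [m] divides [b^2], i.e. [b] ([dvdn_sqr_squarefree]). So the square-zero
    classes are the multiples of [m * s] below [n = s * (m * s)], and [card_ord_dvdn] counts [s] of
    them. *)

Lemma dvdn_sqr_squarefree (m b : nat) : (0 < m)%N ->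
  (forall t, t ^ 2 %| m -> t = 1)%N -> (m %| b ^ 2)%N = (m %| b)%N.
Proof.
move=> m0 sqf; apply/idP/idP => [mb2|]; last by move/dvdn_mulr; apply.
have g0 : (0 < gcdn m b)%N by rewrite gcdn_gt0 m0.
set g := gcdn m b in g0 *.
have [m' Em] : exists m', m = (m' * g)%N by apply/dvdnP/dvdn_gcdl.
have [b' Eb] : exists b', b = (b' * g)%N by apply/dvdnP/dvdn_gcdr.
have cop : coprime m' b'.
  by rewrite /coprime -(eqn_pmul2r g0) mul1n muln_gcdl -Em -Eb.
(* Cancelling one [g] leaves [m'] dividing [b'^2 * g], and [m'] is coprime to [b']. Hence [m'^2]
   divides [m' * g = m]. *)
have m'g : (m' %| g)%N.
  move: mb2; rewrite Em Eb expnMn -[(g ^ 2)%N]mulnn mulnA dvdn_pmul2r //.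
  by rewrite Gauss_dvdr // coprimeXr.
have m'1 : m' = 1%N by apply: sqf; rewrite Em -mulnn dvdn_mul.
by rewrite Em m'1 mul1n dvdn_gcdr.
Qed.

Lemma chi_gt0 (n : nat) : (0 < n)%N -> (0 < chi n)%N.
Proof. by move=> n0; apply: chi_max. Qed.

(** Otherwise [t * chi n] would be a larger number whose square divides [n]; [t = 0] would force
    [m = 0]. *)
Lemma chi_cofactor_squarefree (n m t : nat) : (0 < n)%N ->
  n = (m * chi n ^ 2)%N -> (t ^ 2 %| m -> t = 1)%N.
Proof.
move=> n0 En tm; have s0 := chi_gt0 n n0.
have m0 : (0 < m)%N by move: n0; rewrite En muln_gt0 => /andP[].
have : (t * chi n <= chi n)%N.
  by apply: chi_max => //; rewrite expnMn {2}En dvdn_mul.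
rewrite -{2}[chi n]mul1n leq_pmul2r //.
by case: t tm => [|[]] //; rewrite dvd0n => /eqP Em; rewrite Em in m0.
Qed.

Lemma dvdn_sqr_chi (n m a : nat) : (0 < n)%N -> n = (m * chi n ^ 2)%N ->
  (n %| a ^ 2)%N = (m * chi n %| a)%N.
Proof.
move=> n0 En; have s0 := chi_gt0 n n0.
have m0 : (0 < m)%N by move: n0; rewrite En muln_gt0 => /andP[].
(* Either side forces [chi n] to divide [a]: on the left, [(chi n)^2] divides [n], hence [a^2].
   Otherwise both are false. *)
have [/dvdnP[b ->]|sNa] := boolP (chi n %| a)%N; last first.
  transitivity false; last symmetry; apply: contraNF sNa.
    by move=> na2; rewrite -(@dvdn_pexp2r _ _ 2) // (dvdn_trans (chi_dvd n0)).
  exact/dvdn_trans/dvdn_mull.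
rewrite {1}En expnMn !dvdn_pmul2r ?expn_gt0 ?s0 // dvdn_sqr_squarefree // => t.
exact: chi_cofactor_squarefree n m t n0 En.
Qed.

Lemma Zmod_sqr_eq0 (n : nat) (a : Zmod n) : (0 < n)%N ->
  (a ^+ 2 == 0) = (n %| (a : 'I_n.-1.+1) ^ 2)%N.
Proof.
move=> n0; have {1}-> : a = (a : 'I_n.-1.+1)%:R.
  by rewrite natr_Zmod; apply: val_inj; rewrite /= modn_small.
by rewrite -natrX -[0]/(0%:R) natr_Zmod_eq // mod0n.
Qed.

(** The map sending [i < k] to [i * d] is a bijection onto this set. The bound has the shape
    [.-1.+1] to match the carrier of [Zmod]. *)
Lemma card_ord_dvdn (k d : nat) : (0 < d)%N -> (0 < k)%N ->
  #|[set a : 'I_(k * d).-1.+1 | (d %| a)%N]| = k.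
Proof.
move=> d0 k0; have kd0 : (0 < k * d)%N by rewrite muln_gt0 k0.
have lt_f (i : 'I_k) : (i * d < (k * d).-1.+1)%N.
  by rewrite prednK // ltn_pmul2r.
rewrite -[RHS]card_ord -(@card_imset _ _ (fun i => Ordinal (lt_f i))) => [|i j].
  apply: eq_card => a; rewrite inE; apply/idP/imsetP => [/dvdnP[q Ea]|[i _ ->]].
    have qk : (q < k)%N by rewrite -(ltn_pmul2r d0) -Ea -{2}(prednK kd0).
    by exists (Ordinal qk) => //; apply: val_inj.
  exact: dvdn_mull.
by case=> /eqP; rewrite eqn_pmul2r // => /eqP/val_inj.
Qed.

Theorem theorem4p1 (n : nat) (hn : (1 <= n)%N) :
  chi n = #|[set a : Zmod n | a ^+ 2 == 0]|.
Proof.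
have s0 := chi_gt0 n hn; have [m En] := dvdnP (chi_dvd hn).
have m0 : (0 < m)%N by move: hn; rewrite En muln_gt0 => /andP[].
have Ek : n = (chi n * (m * chi n))%N by rewrite {1}En -mulnn mulnCA.
transitivity #|[set a : 'I_n.-1.+1 | (m * chi n %| a)%N]|.
  (* The left-hand [chi n] becomes a count modulo [chi n * (m * chi n)], which [Ek] folds back to
     [n]. *)
  rewrite -{1}(card_ord_dvdn (chi n) (m * chi n)) ?muln_gt0 ?m0 //.
  by rewrite -Ek.
by apply: eq_card => a; rewrite !inE Zmod_sqr_eq0 // (dvdn_sqr_chi n m _ hn En).
Qed.
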